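(* Let $G$ be a finite simple undirected graph with $n$ vertices and at least one edge, and let $\mu_2$ and $\mu_n$ denote the second smallest and the largest eigenvalue of the Laplacian matrix of $G$, respectively. Let $r$ be a real number with $0 < r \le 1/2$. If $\mu_2 \ge r\mu_n$, then $\alpha'(G) \ge r(n-1)$.
   Context: The Laplacian matrix of a graph $G$ is $L = D - A$, where $D$ is the diagonal matrix of vertex degrees and $A$ is the adjacency matrix. The eigenvalues of $L$ are listed with multiplicity in nondecreasing order $0=\mu_1 \le \mu_2 \le \cdots \le \mu_n$. A matching is a set of pairwise non-adjacent edges, and the matching number $\alpha'(G)$ is the maximum size of a matching in $G$. *)

(* Defs.v *)
From HB Require Import structures.
From mathcomp Require Import all_boot all_order all_algebra.

Set Implicit Arguments.
Unset Strict Implicit.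
Unset Printing Implicit Defensive.

Import Order.TTheory GRing.Theory Num.Theory.

Local Open Scope ring_scope.

(* A finite simple graph on the vertex type [T : finType] is an adjacency
   relation [e : rel T] that is symmetric and irreflexive. *)

Section Graph.

Variables (T : finType) (e : rel T).

Definition degree (x : T) : nat := #|[set y | e x y]|.

Definition edges : {set {set T}} :=
  [set [set p.1; p.2] | p : T * T & e p.1 p.2].

(* Two edges are non-adjacent when they are disjoint as vertex sets. *)
Definition is_matching (M : {set {set T}}) : bool :=
  (M \subset edges) && trivIset M.

Definition matching_number : nat :=
  \max_(M : {set {set T}} | is_matching M) #|M|.

End Graph.

Section Laplacian.

(* Rows and columns are indexed by ['I_#|T|], the vertex of index [i] being
   [enum_val i]. *)
Variables (R : nzRingType) (T : finType) (e : rel T).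

Definition adjacency_mx : 'M[R]_#|T| :=
  \matrix_(i, j) (e (enum_val i) (enum_val j))%:R.

Definition degree_mx : 'M[R]_#|T| :=
  diag_mx (\row_i (degree e (enum_val i))%:R).

Definition laplacian : 'M[R]_#|T| := degree_mx - adjacency_mx.

End Laplacian.

(* [mu] lists the eigenvalues of [A] with (algebraic) multiplicity in
   nondecreasing order: at most one such list exists, and one exists exactly
   when the characteristic polynomial splits over [R], as it does for
   symmetric matrices when [R] is the reals. *)
Definition sorted_spectrum (R : realFieldType) (n : nat) (A : 'M[R]_n)
    (mu : seq R) : Prop :=
  sorted <=%R mu /\ char_poly A = \prod_(a <- mu) ('X - a%:P).

(* Main.v *)
Require Import Defs.
From mathcomp Require Import all_boot all_order all_algebra reals.
From mathcomp Require Import sesquilinear spectral complex.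
From mathcomp Require Import ring lra zify.

(** Let [n] be the number of vertices.  The hard half of the Tutte-Berge
    formula ([tutte_berge_barrier]) gives a set [S] of [s] vertices and a
    partition of its complement [W], of size [w], into [p] parts [B_1, ..., B_p]
    joined by no edge, such that the matching number is at least
    [s + sum_i (b_i - 1) / 2 = s + (w - p) / 2], where [b_i = #|B_i|].

    The spectrum controls [s].  Write [mu_2] and [mu_n] for the second smallest
    and the largest eigenvalue; both are positive, since the sum of the
    eigenvalues is the sum of the degrees and [mu_2 >= r mu_n].  For every set of
    [a] vertices, the number of edges leaving it lies between
    [mu_2 a (n - a) / n] and [mu_n a (n - a) / n] ([cut_bounds], from Rayleigh
    quotients orthogonal to the all-ones vector).  All edges leaving some [B_i]
    go to [S], so the cuts of the parts add up to the cut of [W] ([sum_cut]), and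
    [mu_2 >= r mu_n] gives [r sum_i b_i (n - b_i) <= w s].  As each [b_i] is at
    most [w - p + 1], this implies [s >= r (n - 1 - (w - p))].  Finally
    [(w - p) / 2 >= r (w - p)] since [r <= 1 / 2], and the sum of the two bounds
    is [r (n - 1)].

    The Tutte-Berge inequality is obtained by Gallai's method.  A [W] of minimal
    size such that each vertex outside [W] still accounts for one edge of a
    maximum matching has each of its vertices missed by some maximum matching of
    [W].  Then never being missed simultaneously is an equivalence relation on
    [W] ([never_both_missed_trans], by exchanging edges), adjacent vertices are
    equivalent, and a maximum matching misses at most one vertex per class. *)

Set Implicit Arguments.
Unset Strict Implicit.
Unset Printing Implicit Defensive.

Import Order.TTheory GRing.Theory Num.Theory.

(** * Matchings and Gallai's lemma *)

Section Pairing.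
Variables (T : finType) (e : rel T).
Hypotheses (e_sym : symmetric e) (e_irr : irreflexive e).
Implicit Types (f g : {ffun T -> T}) (W : {set T}) (x y u v w : T).

(** A matching inside [W], encoded as the involution that swaps the two ends of
    each edge and fixes the uncovered vertices. *)
Definition pairing W f : bool :=
  [forall x, (f (f x) == x) && ((f x != x) ==> e x (f x) && (x \in W))].

Definition covered f : {set T} := [set x | f x != x].

Definition max_covered W : nat := \max_(f | pairing W f) #|covered f|.

Definition max_pairing W f : bool :=
  pairing W f && (#|covered f| == max_covered W).

Lemma pairingP W f :
  reflect (involutive f /\ forall x, f x != x -> e x (f x) /\ x \in W)
          (pairing W f).
Proof.
apply: (iffP forallP) => [fP | [fK fe] x].
  by split=> x; have /andP[/eqP // _ /implyP fx] := fP x; move/fx/andP.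
by rewrite fK eqxx; apply/implyP => /fe[-> ->].
Qed.

Lemma pairingS W W' f : W \subset W' -> pairing W f -> pairing W' f.
Proof.
move=> /subsetP sWW' /pairingP[fK fe]; apply/pairingP; split=> // x /fe[exf].
by move/sWW'.
Qed.

Lemma max_pairing_exists W : exists f, max_pairing W f.
Proof.
have idP : pairing W [ffun x => x].
  by apply/pairingP; split=> x; rewrite !ffunE ?eqxx.
exists [arg max_(f > [ffun x => x] | pairing W f) #|covered f|].
case: arg_maxnP => // f fP fmax; rewrite /max_pairing fP /=.
rewrite eqn_leq leq_bigmax_cond //=; apply/bigmax_leqP => g; exact: fmax.
Qed.

Lemma covered_le_max W f : pairing W f -> #|covered f| <= max_covered W.
Proof. by move=> fP; apply: leq_bigmax_cond. Qed.

(** The orbits of size two of [f] partition the covered vertices into edges. *)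
Lemma pairing_matching f : pairing setT f ->
  exists2 M : {set {set T}}, is_matching e M & #|covered f| = #|M| * 2.
Proof.
move=> /pairingP[fK fe]; pose M := [set [set x; f x] | x in covered f].
have covE x y : x \in covered f -> y \in [set x; f x] ->
    y \in covered f /\ [set x; f x] = [set y; f y].
  rewrite !inE => fx /orP[/eqP-> // | /eqP->].
  by rewrite fK setUC eq_sym.
have M_part : partition M (covered f).
  apply/and3P; split.
  - apply/eqP/setP => y; apply/bigcupP/idP => [[_ /imsetP[x xf ->]] | yf].
      by case/(covE _ _ xf).
    by exists [set y; f y]; [exact: imset_f | exact: set21].
  - apply/trivIsetP => _ _ /imsetP[x xf ->] /imsetP[y yf ->].
    apply: contraNT => /pred0Pn[z /= /andP[/(covE _ _ xf)[_ ->]]].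
    by case/(covE _ _ yf) => _ ->.
  - by apply/imsetP => -[x _ /setP/(_ x)]; rewrite !inE eqxx.
exists M; last first.
  apply: (card_uniform_partition _ M_part) => _ /imsetP[x xf ->].
  by rewrite cards2 eq_sym; move: xf; rewrite inE => ->.
apply/andP; split; last exact: partition_trivIset M_part.
apply/subsetP => _ /imsetP[x + ->]; rewrite inE => /fe[exf _].
apply: (imset_f (fun p : T * T => [set p.1; p.2]) (x := (x, f x))).
by rewrite inE.
Qed.

Lemma covered_even W f : pairing W f -> ~~ odd #|covered f|.
Proof.
move=> /(pairingS (subsetT W))/pairing_matching[M _ ->].
by rewrite oddM andbF.
Qed.

Lemma max_covered_matching : max_covered setT <= (matching_number e).*2.
Proof.
apply/bigmax_leqP => f /pairing_matching[M Mm ->].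
by rewrite muln2 leq_double; apply: leq_bigmax_cond.
Qed.

(** Adds the edge [xy] to a matching that misses [x], and drops the edge from
    [y] to [f y] if there is one.  When [y] is missed too, [f y = y] and the
    second test has already caught it, so the matching is augmented. *)
Definition exchange f x y : {ffun T -> T} :=
  [ffun a => if a == x then y else if a == y then x
             else if a == f y then f y else f a].

Section Exchange.
Variables (W : {set T}) (f : {ffun T -> T}) (x y : T).
Hypotheses (fP : pairing W f) (exy : e x y) (xW : x \in W) (yW : y \in W).
Hypothesis fx : f x = x.

Let x_neq_y : x != y.
Proof. by apply: contraTneq exy => ->; rewrite e_irr. Qed.

Lemma pairing_exchange : pairing W (exchange f x y).
Proof.
have /pairingP[fK fe] := fP; have yx : (y == x) = false.
  by rewrite eq_sym (negPf x_neq_y).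
apply/pairingP; split=> a; rewrite !ffunE.
  have [->|ax] := eqVneq a x; first by rewrite yx eqxx.
  have [->|ay] := eqVneq a y; first by rewrite eqxx.
  have [afy|afy] := eqVneq a (f y).
    rewrite afy in ay *; rewrite (negPf ay) eqxx; case: eqP => [fyx|//].
    by case/eqP: x_neq_y; rewrite -[y]fK fyx fx.
  rewrite (inj_eq (inv_inj fK)) (negPf ay) fK.
  rewrite -{1}fx (inj_eq (inv_inj fK)) (negPf ax).
  case: eqP => // fay; by case/eqP: afy; rewrite -fay fK.
have [->|ax] := eqVneq a x; first by move=> _.
have [->|ay] := eqVneq a y; first by rewrite e_sym.
by have [->|afy] := eqVneq a (f y); [rewrite eqxx | move/fe].
Qed.

Lemma covered_exchange :
  covered (exchange f x y) = x |: (y |: (covered f :\ f y)).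
Proof.
apply/setP => a; rewrite !inE ffunE.
have [->|ax] := eqVneq a x; first by rewrite eq_sym x_neq_y.
have [->|ay] := eqVneq a y; first by rewrite x_neq_y.
by have [->|//] := eqVneq a (f y); rewrite eqxx.
Qed.

Lemma card_covered_exchange : 
  #|covered (exchange f x y)| = #|covered f| + (f y == y).*2.
Proof.
have /pairingP[fK fe] := fP.
rewrite covered_exchange !cardsU1 (cardsD1 (f y) (covered f)) !inE.
rewrite fK fx eqxx (negPf x_neq_y) andbF [y == f y]eq_sym.
by case: (f y == y); rewrite /= ?addn0 ?addn2.
Qed.
End Exchange.

(** By Gallai's lemma, this says that the components of the graph induced on
    [W] are factor-critical. *)
Definition critical W : Prop :=
  forall v, v \in W -> exists2 f, max_pairing W f & f v = v.

(** Take [W] of minimal size for the inequality.  If every maximum matching of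
    [W] covered [v], deleting [v] would lose a whole edge, that is two covered
    vertices (covered sets have even size), and [W :\ v] would satisfy the same
    inequality. *)
Lemma critical_set_exists :
  exists2 W, critical W & max_covered W + #|~: W|.*2 <= max_covered setT.
Proof.
pose P W := max_covered W + #|~: W|.*2 <= max_covered setT.
have PT : P setT by rewrite /P setCT cards0 addn0.
have [W PW minW] : exists2 W, P W & forall W', P W' -> #|W| <= #|W'|.
  by exists [arg min_(W < setT | P W) #|W|]; case: arg_minnP.
exists W => // v vW; have [f fmax] := max_pairing_exists (W :\ v).
have /andP[fP /eqP fcard] := fmax; have fPW := pairingS (subsetDl W [set v]) fP.
exists f; last first.
  have /pairingP[_ fe] := fP; apply/eqP/negPn/negP => /fe[_].
  by rewrite !inE eqxx.
rewrite /max_pairing fPW eqn_leq covered_le_max //= leqNgt; apply/negP => lt_f.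
suff /minW : P (W :\ v) by rewrite (cardsD1 v W) vW ltnn.
have [g /andP[gP /eqP gcard]] := max_pairing_exists W.
have := covered_even fP; have := covered_even gP.
rewrite gcard fcard => oddg oddf.
have cardC : #|~: (W :\ v)| = #|~: W|.+1.
  by have := cardsC (W :\ v); have := cardsC W; rewrite (cardsD1 v W) vW; lia.
apply: leq_trans PW; rewrite cardC; move: lt_f; rewrite fcard; lia.
Qed.

Section Gallai.
Variable W : {set T}.
Hypothesis critW : critical W.

(** Gallai's relation, made reflexive: on a critical set every vertex is itself
    missed by some maximum matching. *)
Definition never_both_missed u v : bool :=
  (u == v) || [forall f, max_pairing W f ==> (f u != u) || (f v != v)].
Local Notation R := never_both_missed.

Lemma never_both_missedP u v :
  reflect (u = v \/ forall f, max_pairing W f -> f u = u -> f v != v) (R u v).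
Proof.
apply: (iffP orP) => -[uv | uvP]; try by left; apply/eqP.
  right=> f fmax fu; have /implyP/(_ fmax) := forallP uvP f.
  by rewrite fu eqxx.
right; apply/forallP => f; apply/implyP => fmax.
by have [fu|//] := eqVneq (f u) u; rewrite uvP.
Qed.

Lemma never_both_missed_sym : symmetric R.
Proof.
move=> u v; rewrite /R eq_sym; congr (_ || _).
by apply: eq_forallb => f; rewrite orbC.
Qed.

(** A matching that misses both ends of an edge can be augmented. *)
Lemma adjacent_never_both_missed x y : x \in W -> y \in W -> e x y -> R x y.
Proof.
move=> xW yW exy; apply/never_both_missedP; right=> f /andP[fP /eqP fcard] fx.
apply/eqP => fy; have := covered_le_max (pairing_exchange fP exy xW yW fx).
by rewrite (card_covered_exchange fP exy fx) fy eqxx fcard; lia.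
Qed.

(** Gallai's lemma.  Suppose that a maximum matching [g] misses both [u] and
    [w].  Among the maximum matchings missing [v], let [f] agree with [g] as
    much as possible.  It covers [u] and [w], which [g] misses, so by counting
    there is a vertex [x] other than [v] that [g] covers and [f] misses.
    Exchanging the edge of [f] at [g x] for the edge between [x] and [g x] keeps
    [v] missed and increases the agreement. *)
Lemma never_both_missed_trans u v w :
  v \in W -> R u v -> R v w -> R u w.
Proof.
move=> vW Ruv Rvw; apply/negPn/negP => Nuw.
have uv : u <> v by move=> uv; rewrite uv Rvw in Nuw.
have vw : v <> w by move=> vw; rewrite -vw Ruv in Nuw.
have [g gmax [gu gw]] : exists2 g, max_pairing W g & g u = u /\ g w = w.
  move: Nuw; rewrite negb_or => /andP[_] /forallPn[g].
  rewrite negb_imply negb_or !negbK => /and3P[gmax /eqP gu /eqP gw].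
  by exists g.
have uw : u != w by move: Nuw; rewrite negb_or => /andP[].
have missed f : max_pairing W f -> f v = v -> f u != u /\ f w != w.
  move=> fmax fv; split.
    move: Ruv; rewrite never_both_missed_sym.
    by case/never_both_missedP => [/esym//|]; apply.
  by have /never_both_missedP[//|] := Rvw; apply.
pose agree f := #|[set a | f a == g a]|.
have [f0 f0max f0v] := critW vW.
pose Q f := max_pairing W f && (f v == v).
have Qf0 : Q f0 by rewrite /Q f0max f0v eqxx.
have [f /andP[fmax /eqP fv] f_agree] :
    exists2 f, Q f & forall f', Q f' -> agree f' <= agree f.
  by exists [arg max_(f > f0 | Q f) agree f]; case: arg_maxnP.
have [fu fw] := missed f fmax fv.
have /andP[fP /eqP fcard] := fmax; have /andP[gP /eqP gcard] := gmax.
have /pairingP[fK fe] := fP; have /pairingP[gK ge] := gP.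
have [x xv [gx fx]] : exists2 x, x != v & g x != x /\ f x = x.
  have : 1 < #|covered g :\: covered f|.
    have -> : #|covered g :\: covered f| = #|covered f :\: covered g|.
      apply/eqP; rewrite -(eqn_add2l #|covered g :&: covered f|) cardsID setIC.
      by rewrite cardsID fcard gcard.
    have <- : #|[set u; w]| = 2 by rewrite cards2 uw.
    apply/subset_leq_card/subsetP => z /set2P[] ->.
      by rewrite !inE gu eqxx fu.
    by rewrite !inE gw eqxx fw.
  rewrite (cardsD1 v) => lt1.
  have /card_gt0P[x] : 0 < #|(covered g :\: covered f) :\ v|.
    by case: (_ \in _) lt1 => //; apply: ltnW.
  by rewrite !inE negbK => /and3P[xv /eqP fx gx]; exists x.
have [exy xW] := ge x gx; set y := g x in exy.
have yW : y \in W by have [] := ge y; rewrite // /y gK eq_sym.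
have f'P := pairing_exchange fP exy xW yW fx.
have f'card := card_covered_exchange fP exy fx.
have fy : f y != y.
  apply/eqP => fy; have := covered_le_max f'P.
  by rewrite f'card fcard fy eqxx addn2 ltnNge leqnSn.
have f'v : exchange f x y v = v.
  rewrite ffunE eq_sym (negPf xv).
  have [vy|_] := eqVneq v y; first by rewrite -vy fv eqxx in fy.
  by case: eqP => [<-|].
have Qf' : Q (exchange f x y).
  by rewrite /Q /max_pairing f'P f'card (negPf fy) addn0 fcard eqxx f'v eqxx.
have := f_agree _ Qf'; apply/negP; rewrite -ltnNge.
apply: proper_card; apply/properP; split; last first.
  by exists x; rewrite !inE ?ffunE ?eqxx // fx eq_sym.
apply/subsetP => a; rewrite !inE ffunE => /eqP fga.
have [->//|ax] := eqVneq a x.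
have [->|ay] := eqVneq a y; first by rewrite gK.
have [afy|_] := eqVneq a (f y); last by rewrite fga.
(* Here [a = f y], so [g a = f a = y = g x], which forces [a = x]. *)
by case/eqP: ax; rewrite -[a]gK -fga afy fK /y gK.
Qed.

Definition gallai_classes : {set {set T}} := equivalence_partition R W.

Lemma never_both_missed_equiv : {in W & &, equivalence_rel R}.
Proof.
move=> u v w uW vW wW; split=> [|Ruv]; first by rewrite /R eqxx.
apply/idP/idP; last exact: never_both_missed_trans.
by apply: never_both_missed_trans; rewrite // never_both_missed_sym.
Qed.

Lemma gallai_classes_partition : partition gallai_classes W.
Proof. exact: equivalence_partitionP never_both_missed_equiv. Qed.

(** Two vertices missed by the same maximum matching are in different classes. *)
Lemma card_gallai_classes : #|W| <= max_covered W + #|gallai_classes|.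
Proof.
have [f fmax] := max_pairing_exists W; have /andP[fP /eqP <-] := fmax.
have /pairingP[fK fe] := fP; have part := gallai_classes_partition.
rewrite -(cardsID (covered f)) leq_add ?subset_leq_card ?subsetIr //.
rewrite -(card_in_imset (f := pblock gallai_classes)).
  apply/subset_leq_card/subsetP => _ /imsetP[x /setDP[xW _] ->].
  by rewrite pblock_mem // (cover_partition part).
move=> x y /setDP[xW]; rewrite inE negbK => /eqP fx /setDP[yW].
rewrite inE negbK => /eqP fy eq_xy.
have : y \in pblock gallai_classes x.
  by rewrite eq_xy mem_pblock (cover_partition part).
rewrite (pblock_equivalence_partition never_both_missed_equiv) //.
case/never_both_missedP => // /(_ f fmax fx); by rewrite fy eqxx.
Qed.

Lemma adjacent_same_class x y : x \in W -> y \in W -> e x y ->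
  pblock gallai_classes x = pblock gallai_classes y.
Proof.
move=> xW yW exy; have part := gallai_classes_partition.
apply/esym/same_pblock; first exact: partition_trivIset part.
rewrite (pblock_equivalence_partition never_both_missed_equiv) //.
exact: adjacent_never_both_missed.
Qed.
End Gallai.

(** The hard half of the Tutte-Berge formula: [~: W] is the barrier and [P]
    splits its complement into parts joined by no edge.  Each part of size [b]
    contributes at least [(b - 1) / 2] edges, and each barrier vertex one. *)
Lemma tutte_berge_barrier : exists (W : {set T}) (P : {set {set T}}),
  [/\ partition P W,
      {in W &, forall x y, e x y -> pblock P x = pblock P y} &
      #|~: W|.*2 + #|W| <= (matching_number e).*2 + #|P|].
Proof.
have [W critW leW] := critical_set_exists.
exists W, (gallai_classes W); split.
- exact: gallai_classes_partition.
- by move=> x y; apply: adjacent_same_class.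
- have := card_gallai_classes critW; have := max_covered_matching; lia.
Qed.

End Pairing.

Local Open Scope ring_scope.

(** * Rayleigh quotients of real symmetric matrices *)

Section Rayleigh.
Local Open Scope sesquilinear_scope.

Lemma char_poly_conj (F : fieldType) n (P A : 'M[F]_n) : P \in unitmx ->
  char_poly (invmx P *m A *m P) = char_poly A.
Proof.
move=> Pu; rewrite /char_poly /char_poly_mx.
have E : ('X%:M : 'M[{poly F}]_n)
    = map_mx polyC (invmx P) *m 'X%:M *m map_mx polyC P.
  by rewrite -mulmxA -scalar_mxC mulmxA -map_mxM mulVmx // map_mx1 mul1mx.
rewrite [in LHS]E !map_mxM -mulmxBl -mulmxBr !det_mulmx mulrC mulrA -det_mulmx.
by rewrite -map_mxM mulmxV // map_mx1 det1 mul1r.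
Qed.

(** The spectral theorem is applied over [R[i]], where eigenvalues exist.
    Unique factorization of the characteristic polynomial identifies the
    diagonal entries with the entries of [mu], so they are real. *)
Lemma symmetric_diagonalization (R : rcfType) n (A : 'M[R]_n) (mu : seq R) :
    A^T = A -> char_poly A = \prod_(a <- mu) ('X - a%:P) ->
  exists d : 'I_n -> R, exists2 M : 'M[R[i]]_n, M \is unitarymx &
    perm_eq mu (codom d) /\
    map_mx (real_complex R) A
      = M^t* *m diag_mx (\row_i (real_complex R (d i))) *m M.
Proof.
move=> symA charA; set AC := map_mx _ A.
have AC_normal : AC \is normalmx.
  apply: symmetric_normalmx.
    apply/is_hermitianmxP.
    by rewrite expr0 scale1r map_mx_id /AC ?map_trmx ?symA.
  by apply/mxOverP => i j; rewrite mxE complex_real.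
have Mu := spectral_unitarymx AC.
have /orthomx_spectralP ACE := AC_normal.
move: (spectralmx AC) (spectral_diag AC) Mu ACE => M dC Mu ACE.
have charAC : char_poly AC = \prod_(i < n) ('X - (dC 0 i)%:P).
  rewrite ACE char_poly_conj ?unitarymx_unit //.
  rewrite char_poly_trig ?diag_mx_is_trig //.
  by apply: eq_bigr => i _; rewrite mxE eqxx.
have perm_dC : perm_eq (map (real_complex R) mu) (codom (dC 0)).
  apply/prod_XsubC_eq.
  rewrite big_map /codom /image_mem big_map big_enum /= -charAC -map_char_poly.
  by rewrite charA rmorph_prod; apply: eq_bigr => a _ /=; rewrite map_polyXsubC.
have dCE i : dC 0 i = real_complex R (complex.Re (dC 0 i)).
  have: dC 0 i \in map (real_complex R) mu.
    by rewrite (perm_mem perm_dC) codom_f.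
  by case/mapP => a _ ->.
exists (fun i => complex.Re (dC 0 i)), M => //; split; last first.
  have -> : \row_i real_complex R (complex.Re (dC 0 i)) = dC.
    by apply/rowP => i; rewrite mxE -dCE.
  by rewrite -(invmx_unitary Mu).
have /perm_map /= := perm_dC => /(_ _ (@complex.Re R)).
rewrite -map_comp map_id_in //= /codom /image_mem -map_comp.
by apply.
Qed.

(** In the eigenbasis [M] the two forms [u u^T] and [u A u^T] are the sums of
    [|y_i|^2] and [d_i |y_i|^2].  At most one [d_i] lies below the second
    smallest eigenvalue [mu`_1], and an eigenvector [v] with eigenvalue
    [a < mu`_1] has no other nonzero coordinate than that one.  Orthogonality to
    [v] therefore kills the only coordinate of [u] that could violate the lower
    bound. *)
Lemma rayleigh_bounds (R : rcfType) n (A : 'M[R]_n) (mu : seq R)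
    (a : R) (v u : 'rV[R]_n) :
    A^T = A -> sorted_spectrum A mu ->
    v *m A = a *: v -> v != 0 -> a < mu`_1 -> u *m v^T = 0 ->
  mu`_1 * (u *m u^T) 0 0 <= (u *m A *m u^T) 0 0 <= mu`_n.-1 * (u *m u^T) 0 0.
Proof.
move=> symA [mu_sorted charA] vA v0 a_lt uv0.
have [d [M Mu [perm_d AE]]] := symmetric_diagonalization symA charA.
(* [y w] lists the coordinates of [w] in the eigenbasis. *)
pose f := real_complex R; pose y (w : 'rV[R]_n) := map_mx f w *m M^t*.
have size_mu : size mu = n by rewrite (perm_size perm_d) size_codom card_ord.
have MtM : M^t* *m M = 1%:M by apply: mulmx1C; apply/unitarymxP.
have yM w : y w *m M = map_mx f w by rewrite -mulmxA MtM mulmx1.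
have conj_f m k (B : 'M[R]_(m, k)) : (map_mx f B)^t* = map_mx f B^T.
  apply/matrixP => i j; rewrite !mxE; apply/eqP; rewrite eq_complex /=.
  by rewrite oppr0 !eqxx.
have ytE w : (y w)^t* = M *m map_mx f w^T.
  by rewrite trmx_mul map_mxM /= trmxCK conj_f.
have dotE w w' : map_mx f (w *m w'^T) = y w *m (y w')^t*.
  by rewrite ytE mulmxA yM map_mxM.
have formE w : map_mx f (w *m A *m w^T)
    = y w *m diag_mx (\row_i f (d i)) *m (y w)^t*.
  by rewrite ytE !map_mxM AE !mulmxA.
have sqE : f ((u *m u^T) 0 0) = \sum_i `|y u 0 i| ^+ 2.
  transitivity (map_mx f (u *m u^T) 0 0); first by rewrite [RHS]mxE.
  rewrite dotE mxE; apply: eq_bigr => i _.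
  by rewrite normCK !mxE.
have quadE : f ((u *m A *m u^T) 0 0) = \sum_i f (d i) * `|y u 0 i| ^+ 2.
  transitivity (map_mx f (u *m A *m u^T) 0 0); first by rewrite [RHS]mxE.
  rewrite formE mul_mx_diag mxE; apply: eq_bigr => i _.
  by rewrite normCK !mxE mulrA [f _ * _]mulrC.
have yv_eigen i : d i != a -> y v 0 i = 0.
  have : y v *m diag_mx (\row_i f (d i)) = f a *: y v.
    have := congr1 (fun w => map_mx f w *m M^t*) vA.
    rewrite map_mxM AE map_mxZ -scalemxAl -/(y v) => <-.
    by rewrite !mulmxA -/(y v) -[in RHS]mulmxA (elimT unitarymxP Mu) mulmx1.
  move/rowP/(_ i); rewrite mul_mx_diag !mxE => /eqP.
  rewrite mulrC -subr_eq0 -mulrBl mulf_eq0 subr_eq0 => /orP[/eqP[->]|/eqP //].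
  by rewrite eqxx.
have d_small i j : d i < mu`_1 -> d j < mu`_1 -> i = j.
  move=> di dj; apply/eqP/negPn/negP => ij.
  suff gt1 : leq 2 (count (fun x => x < mu`_1) mu).
    by have := nth_count_lt 0 mu_sorted gt1; rewrite ltxx.
  rewrite (permP perm_d) count_map -sum1_count big_enum_cond /=.
  by rewrite (bigD1 i) //= (bigD1 j) //= eq_sym dj ij.
have yu_small i : d i < mu`_1 -> y u 0 i = 0.
  move=> di; have yv0 j : j != i -> y v 0 j = 0.
    move=> ji; apply: yv_eigen; apply: contraNneq ji => dj.
    by apply/eqP/d_small; rewrite ?dj.
  have : y u *m (y v)^t* = 0 by rewrite -dotE uv0 map_mx0.
  move/rowP/(_ 0); rewrite mxE [RHS]mxE (bigD1 i) //= big1 ?addr0; last first.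
    by move=> j ji; rewrite [X in _ * X]mxE [_^T _ _]mxE yv0 // conjC0 mulr0.
  move/eqP; rewrite [X in _ * X]mxE [_^T _ _]mxE mulf_eq0 conjC_eq0.
  case/orP=> /eqP // yvi.
  case/eqP: v0; apply/eqP; rewrite -(map_mx_eq0 (real_complex R)) -/f -yM.
  suff -> : y v = 0 by rewrite mul0mx eqxx.
  by apply/rowP => j; rewrite [RHS]mxE; have [->|/yv0] := eqVneq j i.
have d_le i : d i <= mu`_n.-1.
  have /(nthP 0)[k k_lt <-] : d i \in mu by rewrite (perm_mem perm_d) codom_f.
  rewrite size_mu in k_lt.
  apply: (sorted_leq_nth le_trans lexx) => //; rewrite ?inE ?size_mu //.
    by case: (n) k_lt.
  by case: (n) k_lt.
have scaledE b : f (b * (u *m u^T) 0 0) = \sum_i f b * `|y u 0 i| ^+ 2.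
  by rewrite -mulr_sumr -sqE [LHS](rmorphM (real_complex R)).
apply/andP; split; rewrite -lecR -/f quadE scaledE; apply: ler_sum => i _.
  have [/yu_small->|di] := ltP (d i) mu`_1.
    by rewrite normr0 expr0n !mulr0.
  by apply: ler_wpM2r; [apply: exprn_ge0 | rewrite /f lecR].
by apply: ler_wpM2r; [apply: exprn_ge0 | rewrite /f lecR].
Qed.

End Rayleigh.

(** * Laplacian quadratic form and edge cuts *)

Definition cut (T : finType) (e : rel T) (A : {set T}) : nat :=
  \sum_(x in A) #|[set y in ~: A | e x y]|.

Section Laplacian.
Variables (R : realFieldType) (T : finType) (e : rel T).
Hypothesis e_sym : symmetric e.
Local Notation L := (laplacian R e).
Local Notation n := #|T|.

Definition indicator (A : {set T}) : 'rV[R]_n := \row_i (enum_val i \in A)%:R.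

Lemma tr_laplacian : L^T = L.
Proof.
rewrite linearB /= tr_diag_mx; congr (_ - _).
by apply/matrixP => i j; rewrite !mxE e_sym.
Qed.

Lemma indicator_mulE (w : 'rV[R]_n) (A : {set T}) :
  (w *m (indicator A)^T) 0 0 = \sum_(i | enum_val i \in A) w 0 i.
Proof.
rewrite mxE [RHS]big_mkcond; apply: eq_bigr => i _; rewrite !mxE.
by case: ifP => _; rewrite ?mulr1 ?mulr0.
Qed.

Lemma sum_enum_val (P : pred T) (F : T -> R) :
  \sum_(i < n | P (enum_val i)) F (enum_val i) = \sum_(x | P x) F x.
Proof.
by rewrite [RHS](reindex (@enum_val T T)) //; apply/onW_bij/enum_val_bij.
Qed.

Lemma indicator_dot (A B : {set T}) :
  (indicator A *m (indicator B)^T) 0 0 = #|A :&: B|%:R.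
Proof.
rewrite indicator_mulE; under eq_bigr => i _ do rewrite mxE.
rewrite -[in RHS]sum1_card natr_sum.
rewrite (sum_enum_val (mem B) (fun x => (x \in A)%:R)) /=.
rewrite [RHS](eq_bigl (fun x => (x \in B) && (x \in A))); last first.
  by move=> x; rewrite inE andbC.
by rewrite big_mkcondr; apply: eq_bigr => x _; case: (x \in A).
Qed.

Lemma indicator_laplacianE (A : {set T}) i : let x := enum_val i in
  (indicator A *m L) 0 i
    = (x \in A)%:R * (degree e x)%:R - #|[set y in A | e x y]|%:R.
Proof.
move=> x; rewrite mulmxBr [LHS]mxE mul_mx_diag !mxE -/x; congr (_ - _).
under eq_bigr => j _ do rewrite !mxE.
rewrite (sum_enum_val predT (fun y => (y \in A)%:R * (e y x)%:R)) /=.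
rewrite -[in RHS]sum1_card natr_sum [RHS]big_mkcond; apply: eq_bigr => y _.
by rewrite inE e_sym -natrM mulnb; case: ifP.
Qed.

Lemma indicatorT_laplacian : indicator setT *m L = 0.
Proof.
apply/rowP => i; rewrite indicator_laplacianE inE mul1r mxE; apply/eqP.
by rewrite subr_eq0 eqr_nat; apply/eqP/eq_card => y; rewrite !inE.
Qed.

(** Row [x] of [1_A L] is the degree of [x] minus the number of its neighbours
    in [A]; for [x] in [A] this counts the neighbours outside [A]. *)
Lemma laplacian_cut (A : {set T}) :
  (indicator A *m L *m (indicator A)^T) 0 0 = (cut e A)%:R.
Proof.
rewrite indicator_mulE natr_sum -(sum_enum_val (mem A)) /=.
apply: eq_bigr => i iA; rewrite indicator_laplacianE iA mul1r.
apply/eqP; rewrite subr_eq addrC -natrD eqr_nat /degree.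
rewrite -(cardsID A); apply/eqP; congr (_ + _)%N;
  by apply: eq_card => y; rewrite !inE andbC.
Qed.
End Laplacian.

(** The indicator of [A] is projected orthogonally to the all-ones vector, the
    eigenvector for the eigenvalue 0, and Rayleigh's bounds are applied to the
    projection.  With [n] vertices and [a = #|A|], the projection times [n] is
    [u = n 1_A - a 1]; it satisfies [u u^T = n a (n - a)] and
    [u L u^T = n^2 cut A]. *)
Lemma cut_bounds (R : rcfType) (T : finType) (e : rel T) (mu : seq R)
    (A : {set T}) :
    symmetric e -> sorted_spectrum (laplacian R e) mu -> 0 < mu`_1 ->
  mu`_1 * (#|A|%:R * (#|T|%:R - #|A|%:R)) <= #|T|%:R * (cut e A)%:R
    <= mu`_(#|T|.-1) * (#|A|%:R * (#|T|%:R - #|A|%:R)).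
Proof.
move=> e_sym mu_spec mu1_gt0.

pose one := indicator R [set: T]; pose v := indicator R A.
pose a : R := #|A|%:R; pose n : R := #|T|%:R.
have dotE (B C : {set T}) :
    indicator R B *m (indicator R C)^T = (#|B :&: C|%:R)%:M.
  by apply/rowP => i; rewrite ord1 indicator_dot !mxE eqxx.
have one1 : one *m one^T = n%:M by rewrite dotE setIT cardsT.
have vone : v *m one^T = a%:M by rewrite dotE setIT.
have onev : one *m v^T = a%:M by rewrite dotE setTI.
have vv : v *m v^T = a%:M by rewrite dotE setIid.
have oneL : one *m laplacian R e = 0 by exact: indicatorT_laplacian.
have Lone : laplacian R e *m one^T = 0.
  by rewrite -[laplacian R e](tr_laplacian R e_sym) -trmx_mul oneL trmx0.
have [n0|n_gt0] := leqP #|T| 0.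
  have -> : A = set0.
    apply/eqP; rewrite -cards_eq0 -leqn0; apply: leq_trans n0.
    exact: max_card.
  have -> : #|T| = 0%N by apply/eqP; rewrite -leqn0.
  by rewrite cards0 !mul0r !mulr0 lexx.
have nR : 0 < n by rewrite ltr0n.
pose u := n *: v - a *: one.
have u1 : u *m one^T = 0.
  by rewrite mulmxBl -!scalemxAl vone one1 !scale_scalar_mx mulrC subrr.
have uT : u^T = n *: v^T - a *: one^T by rewrite linearB !linearZ.
have uu : (u *m u^T) 0 0 = n * (a * (n - a)).
  rewrite [X in _ *m X]uT mulmxBr -!scalemxAr u1 scaler0 subr0.
  rewrite mulmxBl -!scalemxAl vv onev !scale_scalar_mx !mxE eqxx /=; ring.
have uLu : (u *m laplacian R e *m u^T) 0 0 = n * (n * (cut e A)%:R).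
  rewrite mulmxBl -!scalemxAl oneL scaler0 subr0 [X in _ *m X]uT.
  rewrite mulmxBr -!scalemxAr -!scalemxAl -[_ *m one^T]mulmxA.
  rewrite Lone mulmx0 !scaler0 subr0.
  by rewrite 2!mxE laplacian_cut.
have one_neq0 : one != 0.
  apply: contraTneq nR => one0; have := one1; rewrite one0 mul0mx.
  by move/rowP/(_ 0); rewrite !mxE eqxx mulr1n => <-; rewrite ltxx.
have := rayleigh_bounds (tr_laplacian R e_sym) mu_spec _ one_neq0 mu1_gt0 u1.
rewrite oneL scale0r uu uLu => /(_ erefl).
by rewrite !(mulrCA _ n) !ler_pM2l.
Qed.

(** * Matching number and spectrum *)

(** Edges leaving a part of [P] can only go out of [W]. *)
Lemma sum_cut (T : finType) (e : rel T) (W : {set T}) (P : {set {set T}}) :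
    partition P W ->
    {in W &, forall x y, e x y -> pblock P x = pblock P y} ->
  (\sum_(B in P) cut e B = cut e W)%N.
Proof.
move=> part sep; rewrite /cut (set_partition_big _ part).
apply: eq_bigr => B PB.
apply: eq_bigr => x xB; apply: eq_card => y; rewrite !inE.
have xW : x \in W by apply: subsetP xB; apply: partitionS part PB.
have BE : pblock P x = B.
  by apply: def_pblock xB; first exact: partition_trivIset part.
have [exy|] := boolP (e x y); rewrite ?andbF // !andbT; congr negb.
apply/idP/idP => [|yW]; first by move/(subsetP (partitionS part PB)).
by rewrite -BE (sep x y) // mem_pblock (cover_partition part).
Qed.

Lemma size_spectrum (R : realFieldType) n (A : 'M[R]_n) (mu : seq R) :
  sorted_spectrum A mu -> size mu = n.
Proof.
case=> _ charA; apply/eqP.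
by rewrite -eqSS -(size_char_poly A) charA size_prod_XsubC.
Qed.

(** Both sides are the trace of the Laplacian. *)
Lemma sum_laplacian_spectrum (R : realFieldType) (T : finType) (e : rel T)
    (mu : seq R) : irreflexive e -> sorted_spectrum (laplacian R e) mu ->
  \sum_(a <- mu) a = \sum_x (degree e x)%:R.
Proof.
move=> e_irr mu_spec; have [_ charL] := mu_spec.
have size_mu := size_spectrum mu_spec.
have [T0|T_gt0] := posnP #|T|.
  move: size_mu; rewrite T0 => /size0nil->; rewrite big_nil big1 // => x.
  by have := card0_eq T0 x.
have trE : (char_poly (laplacian R e))`_(size mu).-1 = - \tr (laplacian R e).
  by rewrite size_mu char_poly_trace.
move: trE; rewrite charL coefPn_prod_XsubC ?size_mu -?lt0n // => /oppr_inj->.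
rewrite -(sum_enum_val predT); apply: eq_bigr => i _.
by rewrite !mxE eqxx mulr1n e_irr subr0.
Qed.

Lemma last_laplacian_gt0 (R : realFieldType) (T : finType) (e : rel T)
    (mu : seq R) : irreflexive e -> sorted_spectrum (laplacian R e) mu ->
    (exists x y, e x y) ->
  0 < mu`_#|T|.-1.
Proof.
move=> e_irr mu_spec [x0 [y0 exy]]; have [mu_sorted charL] := mu_spec.
have size_mu : size mu = #|T| := size_spectrum mu_spec.
rewrite ltNge; apply/negP => last_le0.
have : \sum_(a <- mu) a <= 0.
  rewrite big_seq; apply: sumr_le0 => a /(nthP 0)[k k_lt <-].
  apply: le_trans last_le0; rewrite size_mu in k_lt.
  by apply: (sorted_leq_nth le_trans lexx) => //; rewrite ?inE ?size_mu; lia.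
rewrite (sum_laplacian_spectrum e_irr mu_spec) (bigD1 x0) //= leNgt.
move/negP; apply.
apply: ltr_wpDr; first by apply: sumr_ge0 => x _; rewrite ler0n.
by rewrite ltr0n; apply/card_gt0P; exists y0; rewrite inE.
Qed.

(** The other parts of [P] are nonempty, so each part has at most
    [#|W| - #|P| + 1] elements; the second bound is the sum of [b^2] when every
    part size [b] has this estimate for one of its two factors. *)
Lemma part_sum_squares (T : finType) (W : {set T}) (P : {set {set T}}) :
    partition P W ->
  (#|P| <= #|W| /\
   \sum_(B in P) #|B| * #|B| + #|W| * #|P| <= #|W| * #|W|.+1)%N.
Proof.
move=> part; have B_gt0 B : B \in P -> (0 < #|B|)%N.
  by move=> PB; rewrite card_gt0; apply: partition_neq0 part PB.
have P_le (Q : {set {set T}}) : Q \subset P -> (#|Q| <= \sum_(B in Q) #|B|)%N.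
  by move=> /subsetP sQP; rewrite -sum1_card; apply: leq_sum => B /sQP/B_gt0.
split; first by rewrite (card_partition part) P_le.
have B_le B : B \in P -> (#|B| + #|P| <= #|W|.+1)%N.
  move=> PB; rewrite (cardsD1 B P) PB (card_partition part) (big_setD1 B) //=.
  by rewrite add1n addnS ltnS leq_add2l P_le ?subsetDl.
rewrite {1 2}(card_partition part) !big_distrl -big_split /=.
by apply: leq_sum => B /B_le; rewrite -mulnDr leq_mul2l => ->; rewrite orbT.
Qed.

Theorem theorem1p3 (R : realType) (T : finType) (e : rel T)
    (e_sym : symmetric e) (e_irr : irreflexive e)
    (e_edge : exists x y : T, e x y)
    (mu : seq R) (mu_spec : sorted_spectrum (laplacian R e) mu)
    (r : R) (r_gt0 : 0 < r) (r_le : r <= 1 / 2)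
    (hmu : r * nth 0 mu #|T|.-1 <= nth 0 mu 1) :
  r * (#|T|%:R - 1) <= (matching_number e)%:R.
Proof.
have mun_gt0 := last_laplacian_gt0 e_irr mu_spec e_edge.
have mu1_gt0 : 0 < mu`_1 by apply: lt_le_trans hmu; rewrite mulr_gt0.
have [W [P [part sep]]] := tutte_berge_barrier e_sym e_irr.
have [P_le sq_le] := part_sum_squares part.
pose m : R := (matching_number e)%:R; pose n : R := #|T|%:R.
pose w : R := #|W|%:R; pose s : R := #|~: W|%:R; pose p : R := #|P|%:R.
move=> le_match.
have matchR : 2 * s + w <= 2 * m + p.
  by rewrite /s /w /m /p -!natrM -!natrD ler_nat !mul2n.
have nE : n = w + s by rewrite /n /w /s -natrD cardsC.
have pw : p <= w by rewrite ler_nat.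
have sqR : \sum_(B in P) (#|B|%:R * #|B|%:R : R) + w * p <= w * (w + 1).
  under eq_bigr do rewrite -natrM.
  by rewrite -natr_sum -natrM -natrD natr1 -natrM ler_nat.
have sumB : \sum_(B in P) (#|B|%:R : R) = w.
  by rewrite -natr_sum -(card_partition part).
(* Lower bounds for the cuts of the parts against the upper bound for [W]. *)
have cutW : r * \sum_(B in P) (#|B|%:R * (n - #|B|%:R)) <= w * s.
  have /andP[_ upper] := cut_bounds W e_sym mu_spec mu1_gt0.
  have ws : #|T|%:R - #|W|%:R = s by rewrite -/n nE [w + s]addrC addrK.
  rewrite -(ler_pM2l mun_gt0); rewrite ws in upper; apply: le_trans upper.
  rewrite -(sum_cut part sep) natr_sum mulrA [_ * r]mulrC.
  rewrite [leLHS]mulr_sumr [leRHS]mulr_sumr; apply: ler_sum => B _.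
  have /andP[lower _] := cut_bounds B e_sym mu_spec mu1_gt0.
  apply: le_trans lower; apply: ler_wpM2r => //.
  by rewrite mulr_ge0 // subr_ge0 ler_nat max_card.
have sqE : \sum_(B in P) (#|B|%:R * (n - #|B|%:R))
    = n * w - \sum_(B in P) (#|B|%:R * #|B|%:R).
  rewrite -sumB mulr_sumr -sumrB; apply: eq_bigr => B _.
  by rewrite mulrBr [n * _]mulrC.
have s_ge0 : 0 <= s by rewrite ler0n.
(* Division of [cutW] by [w], using that a part has size at most [w - p + 1]. *)
have s_ge : r * (n - 1 - (w - p)) <= s.
  have [w0|w_gt0] := leqP #|W| 0.
    have w00 : w = 0 by apply/eqP; rewrite pnatr_eq0 -leqn0.
    have p0 : p = 0 by apply/le_anti; rewrite ler0n -w00 pw.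
    rewrite nE w00 p0 add0r !subr0; nra.
  have wR : 0 < w by rewrite ltr0n.
  rewrite -(ler_pM2l wR); apply: le_trans cutW; rewrite sqE mulrCA ler_pM2l //.
  lra.
(* The hypothesis [r <= 1 / 2] enters here. *)
have rp : r * (w - p) <= (w - p) / 2 by nra.
rewrite -/n -/m; lra.
Qed.
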